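(* $\operatorname{Dist}(\mathrm{PX}(4,3))=2$ and $\rho(\mathrm{PX}(4,3))=3=\lceil 4/3\rceil+1$.
   Context: For integers $n\ge 3$ and $1\le k<n$, the Praeger–Xu graph $\mathrm{PX}(n,k)$ is the simple graph with vertex set $\mathbb Z_n\times\mathbb Z_2^k$; a vertex is written $(i,x)$ with $x=x_0x_1\cdots x_{k-1}$ a bitstring of length $k$. Two vertices $(i,x)$ and $(j,y)$ are adjacent if and only if (after possibly swapping the two vertices) $j=i+1$ in $\mathbb Z_n$ and $x=az_1\cdots z_{k-1}$, $y=z_1\cdots z_{k-1}b$ for some bits $a,b,z_1,\dots,z_{k-1}\in\mathbb Z_2$. For a graph $G$, $\operatorname{Dist}(G)$ is the least $d$ such that some $d$-coloring of the vertices is preserved (class-wise) only by the identity automorphism; if $\operatorname{Dist}(G)=2$, $\rho(G)$ is the minimum size of a color class over all 2-colorings preserved only by the identity automorphism. *)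

(* Defs.v *)
From HB Require Import structures.
From mathcomp Require Import all_boot all_fingroup all_algebra.

Set Implicit Arguments.
Unset Strict Implicit.
Unset Printing Implicit Defensive.

(* A simple graph on the finite vertex type T is given by its adjacency
   relation [e : rel T], assumed symmetric and irreflexive. *)

Definition graph_aut (T : finType) (e : rel T) : {set {perm T}} :=
  [set s : {perm T} | [forall x, forall y, e (s x) (s y) == e x y]].

Definition preserves (T : finType) (d : nat) (c : {ffun T -> 'I_d})
    (s : {perm T}) : bool :=
  [forall x, c (s x) == c x].

Definition distinguishing (T : finType) (e : rel T) (d : nat)
    (c : {ffun T -> 'I_d}) : bool :=
  [forall s in graph_aut e, preserves c s ==> (s == 1%g)].

Definition distinguishable (T : finType) (e : rel T) (d : nat) : bool :=
  [exists c : {ffun T -> 'I_d}, distinguishing e c].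

Lemma ex_distinguishable (T : finType) (e : rel T) :
  exists d, distinguishable e d.
Proof.
exists #|T|; apply/existsP; exists [ffun x => enum_rank x].
apply/forall_inP => s _; apply/implyP => /forallP ps.
apply/eqP/permP => x; rewrite perm1.
by have := ps x; rewrite !ffunE => /eqP/enum_rank_inj.
Qed.

Definition Dist (T : finType) (e : rel T) : nat :=
  ex_minn (ex_distinguishable e).

(* The index value #|T| bounds the size of every color class, so it does not
   affect the minimum as soon as a distinguishing 2-coloring exists; when there
   is none, [rho e] takes the meaningless value #|T|. *)
Definition rho (T : finType) (e : rel T) : nat :=
  \big[minn/#|T|]_(c : {ffun T -> 'I_2} | distinguishing e c)
    \big[minn/#|T|]_(i < 2) #|[set x | c x == i]|.

Definition px_vertex (n k : nat) : finType := ('I_n * k.-tuple bool)%type.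

(* [ordS i] is i + 1 modulo n. *)
Definition px_arc (n k : nat) : rel (px_vertex n k) := fun u v =>
  (v.1 == ordS u.1) &&
  [exists a : bool, exists b : bool, exists z : k.-1.-tuple bool,
     (u.2 == a :: z :> seq bool) && (v.2 == rcons z b :> seq bool)].

Definition PX (n k : nat) : rel (px_vertex n k) := fun u v =>
  px_arc u v || px_arc v u.

Lemma PX_sym (n k : nat) : symmetric (@PX n k).
Proof. by move=> u v; rewrite /PX orbC. Qed.

Lemma PX_irrefl (n k : nat) : 1 < n -> irreflexive (@PX n k).
Proof.
move=> n_gt1 [i x]; rewrite /PX orbb /px_arc /=.
suff /negPf-> : i != ordS i by [].
rewrite -val_eqE /=; have [lt_in|le_ni] := ltnP i.+1 n.
  by rewrite modn_small // neq_ltn ltnSn.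
have def_n : i.+1 = n by apply/eqP; rewrite eqn_leq ltn_ord le_ni.
by rewrite def_n modnn -lt0n -ltnS def_n.
Qed.

Arguments PX n k : clear implicits.

(* Main.v *)
(** Write a 4-cycle as the odd (or even) residues modulo 8 and its edges as the
even (or odd) ones, so that incidence becomes difference 1.  A vertex of PX(4,3)
is a word on Z_4 with one missing position, that is, an edge of the 4-cube
C4 x C4; its coordinates in the two factors are an edge and a vertex.  This
identifies PX(4,3) with the pairs (a,b) of residues modulo 8 with a + b odd, two
pairs being adjacent when they differ by +-1 in both coordinates.  The point
reflection w |-> p + q - w is then a nontrivial automorphism swapping p and q, so
a color class of size at most 2 is never distinguishing.  Conversely, four rounds
of color refinement starting from the class {(0,1), (1,4), (4,7)} separate all
vertices. *)
Require Import Defs.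
From mathcomp Require Import all_boot all_order all_fingroup all_algebra.

Set Implicit Arguments.
Unset Strict Implicit.
Unset Printing Implicit Defensive.

Import Order.TTheory GRing.Theory.

(** * Automorphisms, color refinement, and criteria for Dist and rho *)

Section GraphAut.

Variables (T : finType) (e : rel T).

Lemma graph_autP (s : {perm T}) :
  reflect (forall x y, e (s x) (s y) = e x y) (s \in graph_aut e).
Proof.
rewrite inE; apply: (iffP forallP) => [es x y | es x].
  by have /forallP/(_ y)/eqP := es x.
by apply/forallP => y; rewrite es.
Qed.

Lemma not_distinguishing d (c : {ffun T -> 'I_d}) (s : {perm T}) :
  s \in graph_aut e -> preserves c s -> s != 1%g -> distinguishing e c = false.
Proof.
move=> es cs; apply: contraNF => /forall_inP/(_ s es).
by rewrite cs.
Qed.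

(* A polynomial hash of the color refinement step: the new color of [x] only
   depends on its old color and on the multiset of colors of its neighbors. *)
Definition refine (f : T -> nat) (x : T) : nat := f x + \sum_(y | e x y) f y ^ 2.

Lemma iter_refine_aut (s : {perm T}) (f : T -> nat) k :
    s \in graph_aut e -> (forall x, f (s x) = f x) ->
  forall x, iter k refine f (s x) = iter k refine f x.
Proof.
move=> /graph_autP es fs; elim: k => //= k IHk x.
rewrite /refine IHk (reindex_inj (@perm_inj _ s)) /=.
by congr addn; apply: eq_big => [y | y _]; rewrite ?es ?IHk.
Qed.

(** A color-preserving automorphism fixes every refined value, so injectivity makes it the
    identity. *)
Lemma iter_refine_distinguishing d (c : {ffun T -> 'I_d}) (f : T -> nat) k :
    (forall x y, c x = c y -> f x = f y) -> injective (iter k refine f) ->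
  distinguishing e c.
Proof.
move=> cf f_inj; apply/forall_inP => s es; apply/implyP => /forallP cs.
apply/eqP/permP => x; rewrite perm1; apply/f_inj/iter_refine_aut => // y.
by apply/cf/eqP.
Qed.

(** The vertex [x0] rules out 0 colors, and [s] preserves the only coloring with 1 color. *)
Lemma Dist_eq2 (x0 : T) (s : {perm T}) :
    s \in graph_aut e -> s != 1%g -> distinguishable e 2 ->
  Dist e = 2.
Proof.
move=> es s1 d2; rewrite /Dist; case: ex_minnP => d d_dist /(_ 2 d2).
case: d d_dist => [|[|[|d]]] // /existsP[c]; first by case: (c x0).
by rewrite (not_distinguishing es) //; apply/forallP => x; rewrite !ord1.
Qed.

Lemma rho_eq m (c : {ffun T -> 'I_2}) (i : 'I_2) :
    distinguishing e c -> #|[set x | c x == i]| <= m -> m <= #|T| ->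
    (forall (c' : {ffun T -> 'I_2}) j, distinguishing e c' ->
       m <= #|[set x | c' x == j]|) ->
  rho e = m.
Proof.
move=> ce ci mT le_m; apply/eqP; rewrite eqn_leq; apply/andP; split.
  rewrite /rho -leEnat -!minEnat; apply: (bigmin_inf c) => //.
  exact: (bigmin_inf i).
(* The base case of both minima is their default value [#|T|], whence the hypothesis [m <= #|T|]. *)
rewrite /rho; elim/big_ind: _ => // [a b ma mb|c' ec']; first by rewrite leq_min ma.
elim/big_ind: _ => // [a b ma mb|j _]; first by rewrite leq_min ma.
exact: le_m.
Qed.

End GraphAut.

(** The points may coincide, which covers singletons. *)
Lemma card_le2P (T : finType) (A : {set T}) :
  #|A| <= 2 -> A = set0 \/ exists p q, A = [set p; q].
Proof.
rewrite leq_eqVlt ltnS leq_eqVlt ltnS leqn0 cards_eq0.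
case/or3P => [/cards2P[p [q [_ ->]]] | /cards1P[p ->] | /eqP]; last by left.
  by right; exists p, q.
by right; exists p, p; rewrite setUid.
Qed.

Lemma uniq_map_inj_in (T1 T2 : eqType) (f : T1 -> T2) (s : seq T1) :
  uniq (map f s) -> {in s &, injective f}.
Proof.
move=> fs_uniq x y xs ys fxy.
rewrite -[LHS](nth_index x xs) -[RHS](nth_index x ys); congr nth; apply/eqP.
rewrite -(nth_uniq (f x) _ _ fs_uniq) ?size_map ?index_mem //.
by rewrite !(nth_map x) ?index_mem // !nth_index ?fxy.
Qed.

Lemma px_arcE n k (u v : px_vertex n k.+1) :
  px_arc u v = (v.1 == ordS u.1) && (behead u.2 == take k v.2 :> seq bool).
Proof.
congr andb; apply/existsP/eqP => [[a /existsP[b /existsP[z /andP[]]]] | uv].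
  move=> /eqP-> /eqP->.
  by rewrite /= -cats1 take_size_cat // size_tuple.
exists (thead u.2); apply/existsP; exists (last true v.2).
apply/existsP; exists [tuple of behead u.2]; apply/andP; split.
  by rewrite /= {1}(tuple_eta u.2).
apply/eqP; rewrite /= uv; case/lastP: (tval v.2) (size_tuple v.2) => // s b.
rewrite size_rcons last_rcons => -[<-].
by rewrite -cats1 take_size_cat // cats1.
Qed.

(** * Torus coordinates on PX(4,3) *)

Local Open Scope ring_scope.

Local Notation V := (px_vertex 4 3).
Local Notation W := ('Z_8 * 'Z_8)%type.

(* The 4-cycle of the words [pq] is numbered 00, 10, 11, 01 = 0, 2, 4, 6, and
   the edge between two consecutive words has the number in between. *)
Definition cycle_vertex (p q : bool) : 'Z_8 :=
  if p then if q then 4 else 2 else if q then 6 else 0.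

Definition edge_star_q (q : bool) : 'Z_8 := if q then 5 else 1.

Definition edge_p_star (p : bool) : 'Z_8 := if p then 3 else 7.

(* The bits of (i, x0 x1 x2) occupy the positions i, i+1, i+2 of Z_4; the first
   coordinate reads the positions 0 and 2, the second one 1 and 3. *)
Definition tor (u : V) : W :=
  let x j := nth false u.2 j in
  match val u.1 with
  | 0%N => (cycle_vertex (x 0%N) (x 2%N), edge_p_star (x 1%N))
  | 1%N => (edge_star_q (x 1%N), cycle_vertex (x 0%N) (x 2%N))
  | 2%N => (cycle_vertex (x 2%N) (x 0%N), edge_star_q (x 1%N))
  | _   => (edge_p_star (x 1%N), cycle_vertex (x 2%N) (x 0%N))
  end.

(** [p] and [q] read the two bits of a word back from its number on the 4-cycle. The value is
    meaningful only when [oddw w] holds. *)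
Definition untor (w : W) : V :=
  let p (a : 'Z_8) := a \in [:: 2; 4] in let q (a : 'Z_8) := a \in [:: 4; 6] in
  let: (a, b) := w in
  if odd a then
    if a \in [:: 1; 5] then (inZp 1, [tuple p b; a == 5; q b])
    else (inZp 3, [tuple q b; a == 3; p b])
  else if b \in [:: 1; 5] then (inZp 2, [tuple q a; b == 5; p a])
  else (inZp 0, [tuple p a; b == 3; q a]).

Definition oddw (w : W) : bool := odd w.1 (+) odd w.2.

Definition dirs : seq W := [:: (1, 1); (1, -1); (-1, 1); (-1, -1)].

(** An explicit list, so that claims about all 32 points can be evaluated. *)
Definition oddws : seq W :=
  let zs := [seq inZp i | i <- iota 0 8] in
  [seq w <- [seq (a, b) | a <- zs, b <- zs] | oddw w].

Lemma mem_oddws w : (w \in oddws) = oddw w.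
Proof.
have zs (a : 'Z_8) : a \in [seq inZp i | i <- iota 0 8].
  by rewrite -[a]valZpK map_f // mem_iota ltn_ord.
rewrite mem_filter andb_idr // => _.
by case: w => a b; apply/allpairsP; exists (a, b); rewrite !zs.
Qed.

Lemma torK : cancel tor untor.
Proof.
case=> i [[|a [|b [|c [|? ?]]]] sz] //; case: i => -[|[|[|[|i]]]] lti //;
by case: a sz; case: b; case: c => sz; apply/eqP; vm_compute.
Qed.

Lemma oddw_tor u : oddw (tor u).
Proof.
case: u => i [[|a [|b [|c [|? ?]]]] sz] //; case: i => -[|[|[|[|i]]]] lti //;
by case: a sz; case: b; case: c.
Qed.

Lemma untorK w : oddw w -> tor (untor w) = w.
Proof.
have /allP allK : all (fun w => tor (untor w) == w) oddws by vm_compute.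
by rewrite -mem_oddws => /allK/eqP.
Qed.

Lemma untor_onto u : exists2 w, oddw w & u = untor w.
Proof. by exists (tor u); rewrite ?oddw_tor ?torK. Qed.

Lemma PX_tor u v : PX 4 3 u v = (tor v - tor u \in dirs).
Proof.
have [[w ow ->] [w' ow' ->]] := (untor_onto u, untor_onto v).
rewrite /PX !px_arcE !untorK //.
(* This form of [px_arc] has no quantifiers over tuples, so all pairs can be checked by
   computation. *)
pose adj w w' := let u := untor w in let v := untor w' in
  (v.1 == ordS u.1) && (behead u.2 == take 2 v.2 :> seq bool).
have /allP all_adj : all (fun w => all (fun w' =>
    adj w w' || adj w' w == (w' - w \in dirs)) oddws) oddws by vm_compute.
move: ow ow'; rewrite -!mem_oddws => /all_adj/allP ow /ow.
by move/eqP.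
Qed.

Lemma oddDZ8 (a b : 'Z_8) : odd (a + b)%R = odd a (+) odd b.
Proof. by rewrite -oddD -[RHS](@odd_mod _ 8). Qed.

Lemma oddwD w w' : oddw (w + w') = oddw w (+) oddw w'.
Proof. by rewrite /oddw !oddDZ8 addbACA. Qed.

Lemma oddwN w : oddw (- w) = oddw w.
Proof.
by have := oddwD (- w) w; rewrite addNr; case: (oddw w); case: (oddw (- w)).
Qed.

(** * Point reflections and the lower bound *)

Definition reflect_tor (p q u : V) : V := untor (tor p + tor q - tor u).

Lemma tor_reflect p q u : tor (reflect_tor p q u) = tor p + tor q - tor u.
Proof. by rewrite untorK // !oddwD oddwN !oddw_tor. Qed.

Lemma reflectK p q : involutive (reflect_tor p q).
Proof.
by move=> u; apply: (can_inj torK); rewrite !tor_reflect opprB addrC subrK.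
Qed.

Definition reflection p q : {perm V} := perm (can_inj (reflectK p q)).

(** The reflection negates differences, which amounts to exchanging [u] and [v]. *)
Lemma reflection_aut p q : reflection p q \in graph_aut (PX 4 3).
Proof.
apply/graph_autP => u v; rewrite !permE PX_sym !PX_tor !tor_reflect.
by rewrite opprB [_ + (tor v - _)]addrC addrA subrK.
Qed.

Lemma reflection_neq1 p q : reflection p q != 1%g.
Proof.
have fix_eq w : oddw w -> reflection p q = 1%g -> w + w = tor p + tor q.
  move=> ow /permP/(_ (untor w)); rewrite perm1 permE => /(congr1 tor).
  by rewrite tor_reflect !untorK // => {2}<-; rewrite addrC subrK.
(* The identity would force w + w to be constant, but doubling (1,0) and (0,1) gives (2,0) and
   (0,2). *)
by apply/eqP => r1; have := fix_eq (1, 0) isT r1; rewrite -(fix_eq (0, 1)).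
Qed.

Lemma reflection_set2 p q u :
  (reflection p q u \in [set p; q]) = (u \in [set p; q]).
Proof.
rewrite permE !inE orbC -!(inj_eq (can_inj torK)) tor_reflect.
rewrite !subr_eq [tor p + tor q]addrC (inj_eq (addrI _)).
by rewrite [tor q + _]addrC (inj_eq (addrI _)) ![_ == tor u]eq_sym.
Qed.

Lemma class_gt2 (c : {ffun V -> 'I_2}) i :
  distinguishing (PX 4 3) c -> (2 < #|[set x | c x == i]|)%N.
Proof.
apply: contraLR; rewrite -leqNgt => /(@card_le2P V) cA.
have cE u : (c u == i) = (u \in [set x | c x == i]) by rewrite inE.
have [p [q stab]] : exists p q : V, forall x,
    (c (reflection p q x) == i) = (c x == i).
  case: cA => [A0|[p [q Apq]]].
    (* For an empty class any reflection will do. *)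
    by exists (untor 0), (untor 0) => x; rewrite !cE A0 !in_set0.
  by exists p, q => x; rewrite !cE Apq reflection_set2.
rewrite (not_distinguishing (reflection_aut p q)) ?reflection_neq1 //.
(* With two colors, stabilizing one class stabilizes the other. *)
apply/forallP => x; move: (stab x); rewrite -!val_eqE /=; clear.
by case: (c x) (c _) i => -[|[|?]] // ? [[|[|?]]] // ? [[|[|?]]].
Qed.

(** * A distinguishing class of size three *)

Definition seed : seq W := [:: (0, 1); (1, 4); (4, 7)].

(** This is [refine] in torus coordinates, in a form that can be evaluated. *)
Definition refine_tor (f : W -> nat) (w : W) : nat :=
  (f w + sumn [seq f (w + d)%R ^ 2 | d <- dirs])%N.

Lemma refine_torE (f : V -> nat) (g : W -> nat) :
  (forall u, f u = g (tor u)) ->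
  forall u, refine (PX 4 3) f u = refine_tor g (tor u).
Proof.
move=> fg u; rewrite /refine /refine_tor fg; congr addn.
have odd_d d : d \in dirs -> oddw (tor u + d).
  rewrite oddwD oddw_tor; move: d; exact/allP.
rewrite sumnE big_map.
(* The four translates of [tor u] by [dirs] are distinct and give exactly the neighbors of [u]. *)
transitivity (\sum_(y <- [seq untor (tor u + d)%R | d <- dirs]) f y ^ 2)%N.
  rewrite big_uniq; last first.
    rewrite map_inj_in_uniq // => d d' /odd_d od /odd_d od' /(congr1 tor).
    by rewrite !untorK // => /addrI.
  apply: eq_bigl => y; rewrite PX_tor; apply/idP/mapP => [yd | [d dd ->]].
    by exists (tor y - tor u); rewrite // addrC subrK torK.
  by rewrite untorK ?odd_d // addrC addKr.
rewrite big_map; apply: eq_big_seq => d /odd_d od.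
by rewrite fg untorK.
Qed.

Lemma iter_refine_torE (f : V -> nat) (g : W -> nat) k :
  (forall u, f u = g (tor u)) ->
  forall u, iter k (refine (PX 4 3)) f u = iter k refine_tor g (tor u).
Proof. by move=> fg; elim: k => //= k IHk; apply: refine_torE. Qed.

Lemma refine_seed_inj :
  injective (iter 4 (refine (PX 4 3)) (fun u => (tor u \in seed) : nat)).
Proof.
pose g := iter 4 refine_tor (fun w => (w \in seed) : nat).
have uniq_g : uniq [seq g w | w <- oddws] by vm_compute.
have fg := iter_refine_torE 4 (g := fun w => (w \in seed) : nat) (fun=> erefl).
move=> u v; rewrite !fg -/g => guv; apply: (can_inj torK).
by apply: (uniq_map_inj_in uniq_g) guv; rewrite mem_oddws oddw_tor.
Qed.

Definition seed_coloring : {ffun V -> 'I_2} := [ffun u => inZp (tor u \in seed)].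

Lemma seed_coloring_distinguishing : distinguishing (PX 4 3) seed_coloring.
Proof.
apply: iter_refine_distinguishing refine_seed_inj => u v.
by rewrite !ffunE; case: (_ \in _); case: (_ \in _).
Qed.

Lemma seed_class : (#|[set u | seed_coloring u == 1%R]| <= 3)%N.
Proof.
apply: leq_trans (card_size (map untor seed)); apply/subset_leq_card/subsetP => u.
rewrite inE ffunE => u_seed; apply/mapP; exists (tor u); last by rewrite torK.
by case: (tor u \in seed) u_seed.
Qed.

Theorem theorem6p1 :
  [/\ Dist (PX 4 3) = 2%N,
      rho (PX 4 3) = 3%N
    & 3%:Z = Num.ceil (4 / 3 : rat) + 1].
Proof.
split; last by vm_compute.
  have v0 : V := untor 0.
  apply: (Dist_eq2 v0 (reflection_aut v0 v0) (reflection_neq1 v0 v0)).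
  by apply/existsP; exists seed_coloring; apply: seed_coloring_distinguishing.
apply: (rho_eq seed_coloring_distinguishing seed_class) => [|c j]; last exact: class_gt2.
by rewrite card_prod card_tuple card_ord card_bool.
Qed.
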